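(* Let $I=[a,b]$ be a compact interval, let $(X,d)$ be a metric space, let $F:I\to\mathcal K(X)$ have bounded Hausdorff variation, and let $f:I\to X$ satisfy $f(t)\in F(t)$ for every $t\in I$ and $d(f(s),f(t))\le V_H(F;[s,t])$ for every $a\le s<t\le b$. Then, for every $p>1$ and every nondecreasing $h:I\to\mathbb R$ such that $\mathcal R^H_{p,h}(F;I)<\infty$, the same $f$ satisfies $$\mathcal R_{p,h}(f;[s,t])\le\mathcal R^H_{p,h}(F;[s,t])\qquad\text{for every } a\le s<t\le b.$$ Hence, for every $\theta\in I$ and $x_\theta\in F(\theta)$, there is one selection $f$ of $F$ with $f(\theta)=x_\theta$, satisfying $d(f(s),f(t))\le V_H(F;[s,t])$ and $V(f;[s,t])\le V_H(F;[s,t])$ for every $a\le s<t\le b$, for which the inequality $\mathcal R_{p,h}(f;[s,t])\le\mathcal R^H_{p,h}(F;[s,t])$ holds for every $a\le s<t\le b$, simultaneously for all $p>1$ and all nondecreasing $h:I\to\mathbb R$ with $\mathcal R^H_{p,h}(F;I)<\infty$.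
   Context: $\mathcal K(X)$ is the family of all nonempty compact subsets of $X$ with Hausdorff distance $d_H$. A selection of $F$ is a map $f:I\to X$ with $f(t)\in F(t)$ for all $t\in I$. For $a\le s<t\le b$, $V_H(F;[s,t])=\sup_P\sum_{i=1}^n d_H(F(t_{i-1}),F(t_i))$ and $V(f;[s,t])=\sup_P\sum_{i=1}^n d(f(t_{i-1}),f(t_i))$, where $P$ ranges over all finite partitions $s=t_0<\cdots<t_n=t$; $F$ has bounded Hausdorff variation if $V_H(F;[a,b])<\infty$. Riesz $p$-variation with respect to a clock: for $p>1$, $h:I\to\mathbb R$ nondecreasing and $u:I\to Y$ with $(Y,\rho)$ a metric space, $$\mathcal R_{p,h}(u;[s,t])=\sup_P\sum_{i=1}^n\frac{\rho(u(t_i),u(t_{i-1}))^p}{[h(t_i)-h(t_{i-1})]^{p-1}},$$ the supremum over all finite partitions $P:s=t_0<\cdots<t_n=t$; if $h(t_i)=h(t_{i-1})$, the corresponding term is $0$ when $u(t_i)=u(t_{i-1})$ and $+\infty$ otherwise. $\mathcal R^H_{p,h}(F;[s,t])$ is this quantity for $u=F$, $Y=\mathcal K(X)$, $\rho=d_H$. *)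

(* Defs.v *)
From mathcomp Require Import all_boot all_order all_algebra.
From mathcomp Require Import all_classical all_reals all_analysis.

Set Implicit Arguments.
Unset Strict Implicit.
Unset Printing Implicit Defensive.

Import Order.TTheory GRing.Theory Num.Theory.
Import numFieldNormedType.Exports.

Local Open Scope classical_set_scope.
Local Open Scope ring_scope.

Record compacts (X : topologicalType) := Compacts {
  cset :> set X ;
  cset_compact : compact cset ;
  cset_neq0 : cset !=set0 }.

(* On nonempty compact sets every [sup] and [inf] below is taken over a
   nonempty bounded set of reals, so the default values of [sup] and [inf]
   play no role. *)
Definition hausdorff_dist (R : realType) (X : metricType R)
    (A B : compacts X) : R :=
  Num.max (sup [set inf [set mdist x y | y in (B : set X)] | x in (A : set X)])
          (sup [set inf [set mdist x y | x in (A : set X)] | y in (B : set X)]).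

(* In the definitions below [rho] is the distance of the target space [Y].  A
   partition s = t_0 < ... < t_n = t is encoded by the list l = [t_1; ...; t_n]
   satisfying [itv_partition s t l], and t_i is [nth t (s :: l) i].
   Functions on [a, b] are given as total functions on [R]. *)
Definition metric_variation (R : realType) (Y : Type) (rho : Y -> Y -> R)
    (u : R -> Y) (s t : R) : \bar R :=
  ereal_sup [set (\sum_(0 <= i < size l)
                    rho (u (nth t (s :: l) i)) (u (nth t (s :: l) i.+1)))%:E
            | l in itv_partition s t].

Definition riesz_term (R : realType) (Y : Type) (rho : Y -> Y -> R)
    (p : R) (h : R -> R) (u : R -> Y) (x y : R) : \bar R :=
  if h y == h x then (if `[< u y = u x >] then 0 else +oo)%E
  else (powR (rho (u y) (u x)) p / powR (h y - h x) (p - 1))%:E.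

Definition riesz_variation (R : realType) (Y : Type) (rho : Y -> Y -> R)
    (p : R) (h : R -> R) (u : R -> Y) (s t : R) : \bar R :=
  ereal_sup [set (\sum_(0 <= i < size l)
                    riesz_term rho p h u
                      (nth t (s :: l) i) (nth t (s :: l) i.+1))%E
            | l in itv_partition s t].

Section special_cases.
Context (R : realType) (X : metricType R).

Definition var (f : R -> X) : R -> R -> \bar R :=
  metric_variation (@mdist R X) f.

Definition hvar (F : R -> compacts X) : R -> R -> \bar R :=
  metric_variation (@hausdorff_dist R X) F.

Definition riesz (p : R) (h : R -> R) (f : R -> X) : R -> R -> \bar R :=
  riesz_variation (@mdist R X) p h f.

Definition hriesz (p : R) (h : R -> R) (F : R -> compacts X) :
    R -> R -> \bar R :=
  riesz_variation (@hausdorff_dist R X) p h F.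

Definition selection (a b : R) (F : R -> compacts X) (f : R -> X) : Prop :=
  forall t, t \in `[a, b] -> (F t : set X) (f t).

End special_cases.

(* Main.v *)
Require Import Defs.
From mathcomp Require Import all_boot all_order all_algebra.
From mathcomp Require Import all_classical all_reals all_analysis.
From mathcomp Require Import ring lra.

(* The variation and the Riesz variation are both suprema of partition sums, so
   they are superadditive over adjacent intervals, and a bound between two such
   quantities needs checking only on single pairs x < y.  There,
   d(f x, f y) <= V_H(F; [x, y]), and the p-th power of V_H(F; [x, y]) divided by
   (h y - h x)^(p-1) is at most the Riesz variation of F by Hoelder's inequality
   (in the form of the tangent line inequality for the p-th power).

   A selection with d(f s, f t) <= V_H(F; [s, t]) is built on finitely many
   points by walking away from theta to nearest points; the closed sets of
   functions satisfying the finitely many constraints lie in the compact product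
   of the sets F t and have the finite intersection property. *)

Set Implicit Arguments.
Unset Strict Implicit.
Unset Printing Implicit Defensive.

Import Order.TTheory GRing.Theory Num.Theory.
Import numFieldNormedType.Exports.

Local Open Scope classical_set_scope.
Local Open Scope ring_scope.

(** * Partition sums of an interval function and their suprema *)

Section chain_sums.
Context {R : realType}.
Implicit Types (g : R -> R -> \bar R) (s t x y c : R) (l : seq R).

(** Recursion on the partition lets inductions move the left endpoint. Values are extended reals
    because Riesz terms can be [+oo]. *)
Fixpoint chain_sum g x l : \bar R :=
  if l is y :: l' then (g x y + chain_sum g y l')%E else 0%E.

Definition chain_sup g s t : \bar R :=
  ereal_sup [set chain_sum g s l | l in itv_partition s t].

Lemma chain_sumE g t x l :
  (\sum_(0 <= i < size l) g (nth t (x :: l) i) (nth t (x :: l) i.+1))%E =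
  chain_sum g x l.
Proof.
elim: l x => [|y l IH] x; first by rewrite big_geq.
by rewrite [size _]/= big_nat_recl// [RHS]/= -IH.
Qed.

Lemma chain_sum_cat g x l1 l2 :
  chain_sum g x (l1 ++ l2) = (chain_sum g x l1 + chain_sum g (last x l1) l2)%E.
Proof. by elim: l1 x => [|y l1 IH] x /=; rewrite ?add0e// IH addeA. Qed.

Lemma le_itv_partition s t l : itv_partition s t l -> s <= t.
Proof.
case: l => [/itv_partition_nil->//|x l stl].
by apply/ltW/(@itv_partition_size_neq0 _ _ _ _ (x :: l)).
Qed.

Lemma itv_partition_ex s t : s <= t -> exists l, itv_partition s t l.
Proof.
rewrite le_eqVlt => /predU1P[->|st]; first by exists [::]; split => /=.
by exists [:: t]; exact: itv_partition1.
Qed.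

Lemma chain_sup_ge g s t : s < t -> (g s t <= chain_sup g s t)%E.
Proof.
move=> st; apply: ereal_sup_ubound; exists [:: t]; first exact: itv_partition1.
by rewrite /= adde0.
Qed.

(** A finite [c] can be moved to the other side. If [c] is [+oo], a single nonnegative element of
    [A] already forces [M] to be [+oo]. *)
Lemma ge_ereal_supD (A : set (\bar R)) (c M : \bar R) :
  A !=set0 -> (forall a, A a -> 0 <= a)%E -> (0 <= c)%E ->
  (forall a, A a -> a + c <= M)%E -> (ereal_sup A + c <= M)%E.
Proof.
move=> [a Aa] A0 c0 AcM; have := AcM _ Aa; have := A0 _ Aa.
have [cfin|] := boolP (c \is a fin_num).
  move=> _ _; rewrite -leeBrDr//; apply: ge_ereal_sup => b Ab.
  by rewrite leeBrDr//; exact: AcM.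
rewrite ge0_fin_numE// -leNgt leye_eq => /eqP -> a0.
rewrite addey; first by rewrite leye_eq => /eqP ->; rewrite leey.
by rewrite gt_eqF// (lt_le_trans _ a0).
Qed.

Lemma chain_sup0 s t : s <= t -> chain_sup (fun _ _ => 0%E) s t = 0%E.
Proof.
move=> /itv_partition_ex[l stl]; rewrite /chain_sup.
have chain0 x l' : chain_sum (fun _ _ => 0%E) x l' = 0%E.
  by elim: l' x => //= y l' IH x; rewrite IH adde0.
apply/eqP; rewrite eq_le; apply/andP; split.
  by apply: ge_ereal_sup => _ [l' _ <-]; rewrite chain0.
by apply: ereal_sup_ubound; exists l.
Qed.

Section nonneg.
Variable g : R -> R -> \bar R.
Hypothesis g0 : forall x y, (0 <= g x y)%E.

Lemma chain_sum_ge0 x l : (0 <= chain_sum g x l)%E.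
Proof. by elim: l x => //= y l IH x; rewrite adde_ge0. Qed.

Lemma chain_sup_ge0 s t : s <= t -> (0 <= chain_sup g s t)%E.
Proof.
move=> /itv_partition_ex[l stl]; apply: le_ereal_sup_tmp.
by exists (chain_sum g s l); [exists l|exact: chain_sum_ge0].
Qed.

(** Concatenating partitions of the two halves gives a partition of the whole. The two suprema are
    removed one after the other. *)
Lemma chain_supD s y t : s <= y -> y <= t ->
  (chain_sup g s y + chain_sup g y t <= chain_sup g s t)%E.
Proof.
move=> sy yt; have [l0 syl0] := itv_partition_ex sy.
have [l1 ytl1] := itv_partition_ex yt.
apply: ge_ereal_supD.
- by exists (chain_sum g s l0); exists l0.
- by move=> _ [l _ <-]; exact: chain_sum_ge0.
- exact: chain_sup_ge0.
move=> _ [l syl <-]; rewrite addeC; apply: ge_ereal_supD.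
- by exists (chain_sum g y l1); exists l1.
- by move=> _ [l' _ <-]; exact: chain_sum_ge0.
- exact: chain_sum_ge0.
move=> _ [l' ytl' <-]; apply: ereal_sup_ubound; exists (l ++ l').
  exact: itv_partition_cat syl ytl'.
by rewrite chain_sum_cat addeC; case: syl => _ /eqP ->.
Qed.

Lemma le_chain_sup s' t' s t : s' <= s -> s <= t -> t <= t' ->
  (chain_sup g s t <= chain_sup g s' t')%E.
Proof.
move=> s's st tt'; have s't := le_trans s's st.
apply: le_trans (chain_supD s't tt').
apply: le_trans (leeD (chain_supD s's st) (lexx _)).
by rewrite -addeA addeCA leeDl// adde_ge0 ?chain_sup_ge0.
Qed.

(** Along a partition each term of [g'] is replaced by the supremum for [g] over that step, and
    superadditivity glues the steps together. *)
Lemma chain_sup_le_of_pairs g' s t :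
  (forall x y, s <= x -> x < y -> y <= t ->
    (g' x y <= chain_sup g x y)%E) ->
  (chain_sup g' s t <= chain_sup g s t)%E.
Proof.
move=> g'g; apply: ge_ereal_sup => _ [l stl <-].
elim: l s g'g stl => [|x l IH] s g'g stl /=.
  by rewrite chain_sup_ge0// (le_itv_partition stl).
have /= xtl := itv_partition_cons stl.
have [/= /andP[sx _] _] := stl; have xt := le_itv_partition xtl.
apply: le_trans (chain_supD (ltW sx) xt).
apply: leeD; first exact: g'g.
by apply: IH => // u v xu; apply: g'g; rewrite (le_trans (ltW sx)).
Qed.

End nonneg.
End chain_sums.

Lemma riesz_variationE (R : realType) (Y : Type) (rho : Y -> Y -> R)
    (p : R) (h : R -> R) (u : R -> Y) (s t : R) :
  riesz_variation rho p h u s t = chain_sup (riesz_term rho p h u) s t.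
Proof.
rewrite /riesz_variation /chain_sup; congr ereal_sup.
by apply: eq_imagel => l _; rewrite -(chain_sumE _ t).
Qed.

(** * Lower bounds for the Riesz variation by the ordinary variation *)

Section riesz_estimate.
Context {R : realType}.
Implicit Types (p c r d m : R).

(** Young's inequality for [r] and [c ^ (p - 1)] with exponents [p] and [p / (p - 1)].
    Geometrically, the graph of the [p]-th power lies above its tangent at [c]. *)
Lemma powR_ge_tangent p c r : 1 < p -> 0 <= c -> 0 <= r ->
  p * c `^ (p - 1) * r <= r `^ p + (p - 1) * c `^ p.
Proof.
move=> p1 c0 r0; have p0 : 0 < p by lra.
have q0 : 0 < p / (p - 1) by rewrite divr_gt0//; lra.
have := conjugate_powR r0 (powR_ge0 c (p - 1)) p0 q0.
have pp : (p - 1) * (p / (p - 1)) = p by field; lra.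
rewrite -(powRrM c (p - 1)) pp.
have -> : p^-1 + (p / (p - 1))^-1 = 1 by field; apply/andP; split; lra.
move=> /(_ erefl); rewrite -(ler_pM2l p0) => H.
have -> : p * c `^ (p - 1) * r = p * (r * c `^ (p - 1)) by ring.
apply: (le_trans H); rewrite le_eqVlt; apply/orP; left; apply/eqP.
by field; apply/andP; split; lra.
Qed.

Lemma divr_powRB1 p r d : 0 <= r -> 0 < d ->
  r `^ p / d `^ (p - 1) = (r / d) `^ p * d.
Proof.
move=> r0 d0; rewrite powRM ?invr_ge0 ?(ltW d0)// -mulrA; congr (_ * _).
rewrite -[d^-1]powR_inv1 ?(ltW d0)// -powRrM mulN1r -powRN.
rewrite -[X in _ = _ * X]powRr1 ?(ltW d0)// -powRD; last by rewrite (gt_eqF d0) implybT.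
by congr (_ `^ _); ring.
Qed.

Section riesz.
Context {Y : Type} (rho : Y -> Y -> R).
Hypothesis rho0 : forall u v, 0 <= rho u v.
Hypothesis rhoxx : forall u, rho u u = 0.
Hypothesis rhoC : forall u v, rho u v = rho v u.

Lemma riesz_term_ge0 p (h : R -> R) (u : R -> Y) x y :
  (0 <= riesz_term rho p h u x y)%E.
Proof.
rewrite /riesz_term; case: ifP => _; first by case: ifP => _; rewrite ?leey.
by rewrite lee_fin divr_ge0 ?powR_ge0.
Qed.

(** The tangent inequality at the slope [rho / (h y - h x)], multiplied by [h y - h x]. If
    [h x = h y], the term is [+oo] or both sides vanish. *)
Lemma riesz_term_ge_affine p c (h : R -> R) (u : R -> Y) x y :
  1 < p -> 0 <= c -> h x <= h y ->
  ((p * c `^ (p - 1) * rho (u x) (u y) - (p - 1) * c `^ p * (h y - h x))%:E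
    <= riesz_term rho p h u x y)%E.
Proof.
move=> p1 c0 hxy; rewrite /riesz_term; case: eqVneq => [->|hne].
  case: asboolP => [->|_]; last exact: leey.
  by rewrite rhoxx subrr !mulr0 subrr.
have d0 : 0 < h y - h x by rewrite subr_gt0 lt_neqAle eq_sym hne.
rewrite lee_fin divr_powRB1// (rhoC (u y)).
have H := powR_ge_tangent p1 c0 (divr_ge0 (rho0 (u x) (u y)) (ltW d0)).
rewrite -(ler_pM2r d0) mulrDl mulrA divfK ?gt_eqF// in H.
by rewrite lerBlDr.
Qed.

(** With the same [c] on every step, the termwise bounds add up and the increments of [h]
    telescope. *)
Lemma chain_sum_riesz_ge_affine p c (h : R -> R) (u : R -> Y) x y l :
  1 < p -> 0 <= c -> {in `[x, y] &, nondecreasing_fun h} ->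
  itv_partition x y l ->
  (((p * c `^ (p - 1))%:E * chain_sum (fun v w => (rho (u v) (u w))%:E) x l
     - ((p - 1) * c `^ p * (h y - h x))%:E)
    <= chain_sum (riesz_term rho p h u) x l)%E.
Proof.
move=> p1 c0; elim: l x => [|z l IH] x hh xyl /=.
  by rewrite (itv_partition_nil xyl) subrr mulr0 mule0 sube0.
have [/= /andP[xz _] _] := xyl; have zyl := itv_partition_cons xyl.
have zy := le_itv_partition zyl.
have hz : {in `[z, y] &, nondecreasing_fun h}.
  move=> v w; rewrite !in_itv/= => /andP[? ?] /andP[? ?].
  by apply: hh; rewrite in_itv/=; apply/andP; split => //; lra.
have hxz : h x <= h z.
  by apply: hh (ltW xz); rewrite in_itv/=; apply/andP; split; lra.
apply: le_trans (leeD (riesz_term_ge_affine u p1 c0 hxz) (IH z hz zyl)).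
rewrite ge0_muleDr ?lee_fin//; last first.
  by apply: chain_sum_ge0 => *; rewrite lee_fin.
set S := chain_sum _ z l; set k := p * _; set e := _ * c `^ p.
rewrite le_eqVlt; apply/orP; left; apply/eqP.
by rewrite -EFinM addeAC -EFinD addeA [RHS]addeAC -EFinD; congr (_%:E + _)%E; ring.
Qed.

(* The bound is affine in the chain sum, so it survives the passage to the
   supremum; the slope parameter [c = m / (h y - h x)] makes it sharp. *)
Lemma powR_le_riesz_variation p (h : R -> R) (u : R -> Y) x y m :
  1 < p -> {in `[x, y] &, nondecreasing_fun h} -> x <= y -> h x < h y ->
  0 <= m ->
  (m%:E <= chain_sup (fun v w => (rho (u v) (u w))%:E) x y)%E ->
  ((m `^ p / (h y - h x) `^ (p - 1))%:E
    <= chain_sup (riesz_term rho p h u) x y)%E.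
Proof.
move=> p1 hh xy hxy; rewrite le_eqVlt => /predU1P[<- _|m0 mV].
  rewrite powR0 ?mul0r; last by rewrite gt_eqF//; lra.
  by apply: chain_sup_ge0 => // *; exact: riesz_term_ge0.
have d0 : 0 < h y - h x by rewrite subr_gt0.
rewrite divr_powRB1 ?(ltW m0)//; set c := m / _; set d := h y - h x.
have c0 : 0 < c by rewrite divr_gt0.
set H := chain_sup _ x y.
have H0 : (0 <= H)%E by apply: chain_sup_ge0 => // *; exact: riesz_term_ge0.
have [Hfin|] := boolP (H \is a fin_num); last first.
  by rewrite ge0_fin_numE// -leNgt leye_eq => /eqP ->; rewrite leey.
set k := p * c `^ (p - 1).
have k0 : 0 < k by rewrite mulr_gt0 ?powR_gt0//; lra.
(* Solved for [m], this is a bound satisfied by every partition sum of [rho], hence by their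
   supremum, which dominates [m]. *)
have : ((k * m)%:E - ((p - 1) * c `^ p * d)%:E <= H)%E.
  rewrite leeBlDr// -(fineK Hfin) -EFinD lee_fin -ler_pdivlMl// -lee_fin.
  apply: (le_trans mV); apply: ge_ereal_sup => _ [l xyl <-].
  have := chain_sum_riesz_ge_affine u p1 (ltW c0) hh xyl.
  have /[swap]/le_trans/[apply] : (chain_sum (riesz_term rho p h u) x l <= H)%E.
    by apply: ereal_sup_ubound; exists l.
  rewrite -/k leeBlDr// -(fineK Hfin) -EFinD EFinM muleC -lee_pdivlMr//.
  by rewrite muleC.
apply: le_trans; rewrite -EFinB lee_fin /k.
(* With [m = c * d] the left side becomes [p * c ^ p * d - (p - 1) * c ^ p * d], which is
   [c ^ p * d]. *)
have -> : m = c * d by rewrite /c divfK// gt_eqF.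
have -> : p * c `^ (p - 1) * (c * d) = p * (c * c `^ (p - 1)) * d by ring.
rewrite mulr_powRB1 ?(ltW c0)//; last lra.
by rewrite le_eqVlt; apply/orP; left; apply/eqP; ring.
Qed.

End riesz.
End riesz_estimate.

(** * The Hausdorff distance and nearest points *)

Section hausdorff_distance.
Context {R : realType} {X : metricType R}.
Implicit Types (A B : compacts X) (x y : X).

Lemma mdist_continuous x : continuous (mdist x : X -> R).
Proof.
move=> y; apply/cvgrPdist_le => e e0; near=> z.
have zy : mdist y z <= e by near: z; apply: metricType_numDomainType.cvgr_dist_le.
rewrite ler_norml; have := metric_triangle x y z; have := metric_triangle x z y.
by rewrite (metric_sym z y); lra.
Unshelve. all: by end_near. Qed.

(** A set without a supremum has the default value 0 for [sup]. *)
Lemma sup_ge0 (E : set R) : (forall r, E r -> 0 <= r) -> 0 <= sup E.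
Proof.
move=> E0; have [[[r Er] Eb]|/sup_out->//] := pselect (has_sup E).
by apply: (le_trans (E0 _ Er)); exact: ub_le_sup.
Qed.

Lemma hausdorff_dist_ge0 A B : 0 <= hausdorff_dist A B.
Proof.
rewrite le_max; apply/orP; left; apply: sup_ge0 => _ [x _ <-].
have [y By] := cset_neq0 B; apply: lb_le_inf; first by exists (mdist x y), y.
by move=> _ [z _ <-]; exact: mdist_ge0.
Qed.

Lemma hausdorff_distC A B : hausdorff_dist A B = hausdorff_dist B A.
Proof.
rewrite /hausdorff_dist maxC; congr (Num.max (sup _) (sup _)).
all: apply: eq_imagel => y _; congr inf.
all: by apply: eq_imagel => x _; exact: metric_sym.
Qed.

Lemma hausdorff_distxx A : hausdorff_dist A A = 0.
Proof.
apply/eqP; rewrite eq_le hausdorff_dist_ge0 andbT /hausdorff_dist.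
have H (f : X -> X -> R) : (forall x, f x x = 0) -> (forall x y, 0 <= f x y) ->
    sup [set inf [set f x y | y in (A : set X)] | x in (A : set X)] <= 0.
  move=> fxx f0; have [a Aa] := cset_neq0 A; apply: ge_sup.
    by exists (inf [set f a y | y in (A : set X)]), a.
  move=> _ [x Ax <-]; apply: ge_inf; last by exists x.
  by exists 0 => _ [y _ <-].
rewrite ge_max; apply/andP; split; first by apply: H => *; rewrite ?mdistxx ?mdist_ge0.
by apply: (H (fun x y => mdist y x)) => *; rewrite ?mdistxx ?mdist_ge0.
Qed.

(** Compactness of [B] gives a point attaining the infimum of the distances from [x]. Compactness of
    [A] bounds these infima above as [x] varies, so that each is at most their supremum. *)
Lemma hausdorff_nearest A B x : (A : set X) x ->
  exists2 y, (B : set X) y & mdist x y <= hausdorff_dist A B.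
Proof.
move=> Ax; have [y /set_mem By ymin] := compact_EVT_min (cset_neq0 B)
  (@cset_compact _ B) (continuous_subspaceT (@mdist_continuous x)).
exists y => //; rewrite le_max; apply/orP; left.
have [y0 By0] := cset_neq0 B.
have [M [_ HM]] : bounded_set [set mdist y0 z | z in (A : set X)].
  apply: compact_bounded; apply: continuous_compact (@cset_compact _ A).
  exact: continuous_subspaceT (@mdist_continuous y0).
have infle z : inf [set mdist z y | y in (B : set X)] <= mdist y0 z.
  apply: ge_inf; last by exists y0 => //; exact: metric_sym.
  by exists 0 => _ [w _ <-]; exact: mdist_ge0.
apply: (@le_trans _ _ (inf [set mdist x y | y in (B : set X)])).
  apply: lb_le_inf; first by exists (mdist x y), y.
  by move=> _ [w Bw <-]; apply: ymin; exact/mem_set.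
apply: ub_le_sup; last by exists x.
(* [bounded_set] provides bounds only for numbers strictly above [M]. *)
exists (M + 1) => _ [z Az <-]; apply: (le_trans (infle z)).
apply: le_trans (ler_norm _) _; apply: HM; last by exists z.
by rewrite ltrDl.
Qed.

End hausdorff_distance.

(** * Selections controlled by the Hausdorff variation *)

Section selections.
Context {R : realType} {X : metricType R}.
Variable F : R -> compacts X.

Lemma hvarE s t :
  hvar F s t = chain_sup (fun x y => (hausdorff_dist (F x) (F y))%:E) s t.
Proof.
rewrite /hvar /metric_variation /chain_sup; congr ereal_sup.
by apply: eq_imagel => l _; rewrite -(chain_sumE _ t) sumEFin.
Qed.

Let gH0 x y : (0 <= (hausdorff_dist (F x) (F y))%:E)%E.
Proof. by rewrite lee_fin hausdorff_dist_ge0. Qed.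

Lemma hvarD s y t : s <= y -> y <= t -> (hvar F s y + hvar F y t <= hvar F s t)%E.
Proof. by rewrite !hvarE; exact: chain_supD. Qed.

Lemma hvar_ge0 s t : s <= t -> (0 <= hvar F s t)%E.
Proof. by rewrite hvarE; exact: chain_sup_ge0. Qed.

Lemma hausdorff_dist_le_hvar s t : s < t ->
  ((hausdorff_dist (F s) (F t))%:E <= hvar F s t)%E.
Proof. by rewrite hvarE; exact: chain_sup_ge. Qed.

Let point_in t : {x : X | (F t : set X) x}.
Proof. exact/cid/cset_neq0. Qed.

(* Stated for an abstract relation so that it can be used with [<] to the right
   of the base point and with [>] to its left. *)
Lemma selection_on_path (r : rel R) (W : R -> R -> \bar R) x s l :
  transitive r -> irreflexive r ->
  (forall u v, r u v -> ((hausdorff_dist (F u) (F v))%:E <= W u v)%E) ->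
  (forall u v w, r u v -> r v w -> (W u v + W v w <= W u w)%E) ->
  path r s l -> (F s : set X) x ->
  exists f : R -> X, [/\ forall t, (F t : set X) (f t), f s = x &
    {in s :: l &, forall u v, r u v -> ((mdist (f u) (f v))%:E <= W u v)%E}].
Proof.
move=> rtr rirr HW WD; elim: l s x => [|y l IH] s x.
  move=> _ Fsx; exists (fun t => if t == s then x else sval (point_in t)).
  split; [|by rewrite eqxx|].
    by move=> t; case: eqP => [->//|_]; exact: (svalP (point_in t)).
  by move=> u v; rewrite !inE => /eqP -> /eqP ->; rewrite rirr.
move=> /andP[/= sy yl] Fsx.
(* The walk continues from a point [z] of [F y] nearest to [x]; afterwards only the value at [s] is
   changed. *)
have [z Fyz xz] := hausdorff_nearest (F y) Fsx.
have [f [Ff fy fW]] := IH y z yl Fyz.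
have sl t : t \in y :: l -> r s t.
  rewrite inE => /predU1P[->//|tl]; apply: (rtr _ _ _ sy).
  by move: t tl; exact/allP/(order_path_min rtr).
exists (fun t => if t == s then x else f t); split; [|by rewrite eqxx|].
  by move=> t; case: eqP => [->//|_].
have nes t : t \in y :: l -> (t == s) = false.
  by move=> /sl; apply: contraTF => /eqP ->; rewrite rirr.
move=> u v; rewrite (in_cons s) (in_cons s _ v).
move=> /predU1P[->|ul] /predU1P[->|vl]; first by rewrite rirr.
- move=> sv; rewrite eqxx (nes _ vl).
  have xzW : ((mdist x z)%:E <= W s y)%E.
    by apply: le_trans (HW _ _ sy); rewrite lee_fin.
  have [->|vy] := eqVneq v y; first by rewrite fy.
  have yv : r y v.
    move: vl; rewrite inE (negbTE vy)/= => vl.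
    by move: v vl {sv vy}; exact/allP/(order_path_min rtr).
  (* The triangle inequality through [z] matches the superadditivity of [W] at [y]. *)
  apply: le_trans (WD _ _ _ sy yv).
  apply: (@le_trans _ _ ((mdist x z)%:E + (mdist z (f v))%:E)%E).
    by rewrite -EFinD lee_fin metric_triangle.
  by apply: leeD => //; rewrite -fy; apply: fW => //; exact: mem_head.
- by move=> us; move: (rtr _ _ _ us (sl _ ul)); rewrite rirr.
- by rewrite !nes//; exact: fW.
Qed.

(** Sorting and removing duplicates makes the path strict. *)
Lemma lt_path_above theta (T : seq R) :
  exists2 l, path <%R theta l & {in T, forall t, theta <= t -> t \in theta :: l}.
Proof.
exists (sort <=%R (undup [seq t <- T | theta < t])).
  rewrite path_min_sorted ?sort_lt_sorted ?undup_uniq//.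
  by apply/allP => t; rewrite mem_sort mem_undup mem_filter => /andP[].
move=> t tT; rewrite le_eqVlt inE eq_sym => /predU1P[->|tt]; first by rewrite eqxx.
by rewrite mem_sort mem_undup mem_filter tt tT orbT.
Qed.

Lemma gt_path_below theta (T : seq R) :
  exists2 l, path >%R theta l & {in T, forall t, t <= theta -> t \in theta :: l}.
Proof.
exists (rev (sort <=%R (undup [seq t <- T | t < theta]))).
  rewrite path_min_sorted; first by rewrite rev_sorted sort_lt_sorted undup_uniq.
  by apply/allP => t; rewrite mem_rev mem_sort mem_undup mem_filter => /andP[].
move=> t tT; rewrite le_eqVlt inE => /predU1P[->|tt]; first by rewrite eqxx.
by rewrite mem_rev mem_sort mem_undup mem_filter tt tT orbT.
Qed.

(** The walks to the right and to the left of [theta] both start at [x], so they can be glued.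
    Points on opposite sides are compared through [x], using superadditivity of [hvar] at
    [theta]. *)
Lemma selection_on_finite theta x (T : seq R) : (F theta : set X) x ->
  exists f : R -> X, [/\ forall t, (F t : set X) (f t), f theta = x &
    {in T &, forall s t, s < t -> ((mdist (f s) (f t))%:E <= hvar F s t)%E}].
Proof.
move=> Fx; have [lr plr Tlr] := lt_path_above theta T.
have [ll pll Tll] := gt_path_below theta T.
have [|fr [Ffr frx frV]] := selection_on_path (W := hvar F) lt_trans
    (@ltxx _ _) hausdorff_dist_le_hvar _ plr Fx.
  by move=> u v w uv vw; apply: hvarD; exact: ltW.
have [| | | |fl [Ffl flx flV]] := @selection_on_path >%R (fun u v => hvar F v u)
    x theta ll _ _ _ _ pll Fx.
- by move=> u v w /= uv vw; exact: lt_trans vw uv.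
- by move=> u; exact: ltxx.
- by move=> u v /= uv; rewrite hausdorff_distC; exact: hausdorff_dist_le_hvar.
- by move=> u v w /= uv vw; rewrite addeC; apply: hvarD; exact: ltW.
exists (fun t => if t < theta then fl t else fr t); split.
- by move=> t; case: ifP.
- by rewrite ltxx.
have frV' t : t \in T -> theta <= t -> ((mdist x (fr t))%:E <= hvar F theta t)%E.
  move=> tT; rewrite le_eqVlt => /predU1P[<-|tt].
    by rewrite frx mdistxx hvar_ge0.
  by rewrite -frx; apply: frV => //; [exact: mem_head|apply: Tlr => //; exact: ltW].
move=> s t sT tT st; case: (ltP s theta) => hs; case: (ltP t theta) => ht.
- by rewrite metric_sym; apply: flV; rewrite ?Tll// ltW.
- apply: le_trans (hvarD (ltW hs) ht).
  apply: (@le_trans _ _ ((mdist (fl s) x)%:E + (mdist x (fr t))%:E)%E).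
    by rewrite -EFinD lee_fin metric_triangle.
  apply: leeD; last exact: frV'.
  rewrite -flx metric_sym; apply: flV => //; first exact: mem_head.
  by apply: Tll => //; exact: ltW.
- by have := lt_trans st ht; rewrite ltNge hs.
- by apply: frV; rewrite ?Tlr.
Qed.

(** Lets a distance constraint pass to cluster points in the product topology. *)
Lemma continuous_mdist_proj s t :
  continuous (fun f : prod_topology (fun _ : R => X) => mdist (f s) (f t)).
Proof.
move=> f; apply/(@cvgrPdist_le _ _ _ _ (nbhs_filter f)) => e e0.
have e20 : 0 < e / 2 by rewrite divr_gt0.
have Hs := @metricType_numDomainType.cvgr_dist_le _ _ _ _ (nbhs_filter f) _ _
  (@proj_continuous R (fun=> X) s f) _ e20.
have Ht := @metricType_numDomainType.cvgr_dist_le _ _ _ _ (nbhs_filter f) _ _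
  (@proj_continuous R (fun=> X) t f) _ e20.
near=> g.
have gs : mdist (f s) (g s) <= e / 2 by near: g; exact: Hs.
have gt : mdist (f t) (g t) <= e / 2 by near: g; exact: Ht.
have := metric_triangle (f s) (g s) (f t).
have := metric_triangle (g s) (g t) (f t).
have := metric_triangle (g s) (f s) (g t).
have := metric_triangle (f s) (f t) (g t).
rewrite (metric_sym (g s) (f s)) (metric_sym (g t) (f t)) ler_norml => *; lra.
Unshelve. all: by end_near. Qed.

(* The constraints on finitely many points have a common solution, so by
   Tychonoff's theorem all constraints do. *)
Lemma selection_ex theta x : (F theta : set X) x ->
  exists f : R -> X, [/\ forall t, (F t : set X) (f t), f theta = x &
    forall s t, s < t -> ((mdist (f s) (f t))%:E <= hvar F s t)%E].
Proof.
(* Shrinking the factor at [theta] to the singleton of [x] builds the prescribed value into the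
   compact product. *)
move=> Fx; pose A t := if t == theta then [set x] else (F t : set X).
pose K : set (prod_topology (fun _ : R => X)) := [set f | forall t, A t (f t)].
have cK : compact K.
  apply: (@tychonoff R (fun=> X)) => t; rewrite /A.
  by case: ifP => _; [exact: compact_set1|exact: cset_compact].
pose B (T : seq R) : set (prod_topology (fun _ : R => X)) := K `&`
  [set f | {in T &, forall s t, s < t -> ((mdist (f s) (f t))%:E <= hvar F s t)%E}].
have KF f : K f <-> (forall t, (F t : set X) (f t)) /\ f theta = x.
  split=> [Kf|[Ff fx] t]; last by rewrite /A; case: eqP => [->|].
  split=> [t|]; last by have := Kf theta; rewrite /A eqxx.
  by have := Kf t; rewrite /A; case: eqP => [->/= ->|].
(* The sets [B T] form a filter base, since [B (T1 ++ T2)] lies in both [B T1] and [B T2]; they are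
   nonempty by the finite case. *)
have FB : Filter (filter_from setT B).
  apply: filter_from_filter; first by exists [::].
  move=> T1 T2 _ _; exists (T1 ++ T2) => // f [Kf fV].
  by split; split => // s t sT tT; apply: fV; rewrite mem_cat ?sT ?tT ?orbT.
have PB : ProperFilter (filter_from setT B).
  apply: filter_from_proper => T _.
  by have [f [Ff fx fV]] := selection_on_finite T Fx; exists f; split => //; exact/KF.
have [|f [Kf clf]] := cK _ PB; first by exists [::] => // f [].
have [Ff fx] := (KF f).1 Kf; exists f; split => // s t st.
have [Vfin|] := boolP (hvar F s t \is a fin_num); last first.
  by rewrite ge0_fin_numE ?(hvar_ge0 (ltW st))// -leNgt leye_eq => /eqP ->; rewrite leey.
rewrite -(fineK Vfin) lee_fin; apply/ler_addgt0Pr => e e0.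
(* The cluster point [f] has arbitrarily close functions [g] satisfying the constraint at [s] and
   [t], so [f] satisfies it up to [e]. *)
have /(clf (B [:: s; t])) : nbhs f
    [set g : prod_topology (fun _ : R => X) | `|mdist (f s) (f t) - mdist (g s) (g t)| < e].
  exact: (@cvgr_dist_lt _ _ _ _ (nbhs_filter f) _ _ (@continuous_mdist_proj s t f) _ e0).
move=> /(_ (ex_intro2 _ _ [:: s; t] I (@subset_refl _ _)))[g [[_ gV] /=]].
have : mdist (g s) (g t) <= fine (hvar F s t).
  by rewrite -lee_fin (fineK Vfin); apply: gV => //; rewrite !inE eqxx ?orbT.
by rewrite ltr_norml => ? /andP[]; lra.
Qed.

End selections.

(** * Comparison of the variations of [f] and [F] *)

Section variation_bounds.
Context {R : realType} {X : metricType R}.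
Variables (F : R -> compacts X) (f : R -> X) (a b : R).
Hypothesis fV : forall s t : R, a <= s -> s < t -> t <= b ->
  ((mdist (f s) (f t))%:E <= hvar F s t)%E.

Lemma var_le_hvar s t : a <= s -> t <= b -> (var f s t <= hvar F s t)%E.
Proof.
move=> sa tb; rewrite hvarE.
have -> : var f s t = chain_sup (fun x y => (mdist (f x) (f y))%:E) s t.
  rewrite /var /metric_variation /chain_sup; congr ereal_sup.
  by apply: eq_imagel => l _; rewrite -(chain_sumE _ t) sumEFin.
apply: chain_sup_le_of_pairs => [x y|x y sx xy yt].
  by rewrite lee_fin hausdorff_dist_ge0.
by rewrite -hvarE; apply: fV => //; [exact: le_trans sx|exact: le_trans tb].
Qed.

(** It suffices to treat pairs [x < y]. If [h x < h y], the sharp affine bound applies with [m] the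
    distance from [f x] to [f y]; if [h x = h y], the Riesz term of [f] turns out to be 0. *)
Lemma riesz_le_hriesz (p : R) (h : R -> R) s t : 1 < p ->
  {in `[a, b] &, nondecreasing_fun h} -> (hriesz p h F a b < +oo)%E ->
  a <= s -> t <= b -> (riesz p h f s t <= hriesz p h F s t)%E.
Proof.
move=> p1 hh; rewrite /riesz /hriesz !riesz_variationE => Rfin sa tb.
have R0 x y : (0 <= riesz_term (@hausdorff_dist R X) p h F x y)%E.
  exact: riesz_term_ge0.
apply: chain_sup_le_of_pairs => // x y sx xy yt.
have ax := le_trans sa sx; have yb := le_trans yt tb.
have hxy : {in `[x, y] &, nondecreasing_fun h}.
  move=> v w; rewrite !in_itv/= => /andP[? ?] /andP[? ?].
  by apply: hh; rewrite in_itv/=; apply/andP; split; lra.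
rewrite {1}/riesz_term; case: eqVneq => [hE|hne]; last first.
  rewrite metric_sym; apply: powR_le_riesz_variation => //.
  - exact: hausdorff_dist_ge0.
  - exact: hausdorff_distxx.
  - exact: hausdorff_distC.
  - exact: ltW.
  - rewrite lt_neqAle eq_sym hne; apply: hxy (ltW xy);
      by rewrite in_itv/= lexx ltW.
  - exact: mdist_ge0.
  - by rewrite -hvarE; exact: fV.
(* On an interval where [h] is constant, finiteness forces [F] to be constant. *)
have Fconst z : x <= z -> z <= y -> F z = F x.
  rewrite le_eqVlt => /predU1P[->//|xz] zy.
  have hz : h z = h x.
    apply/le_anti/andP; split; last first.
      by apply: (hxy _ _ _ _ (ltW xz)); rewrite in_itv/= ?lexx ?zy ?(ltW xz) ?(ltW xy).
    by rewrite -hE; apply: (hxy _ _ _ _ zy); rewrite in_itv/= ?lexx ?zy ?(ltW xz) ?(ltW xy).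
  have : (riesz_term (@hausdorff_dist R X) p h F x z < +oo)%E.
    apply: le_lt_trans Rfin; apply: le_trans (le_chain_sup R0 ax (ltW xz) (le_trans zy yb)).
    exact: chain_sup_ge.
  by rewrite /riesz_term hz eqxx; case: asboolP => //; rewrite ltxx.
(* Vanishing variation of [F] forces [f x = f y], which selects the value 0 rather than [+oo] in the
   Riesz term. *)
suff V0 : (hvar F x y <= 0)%E.
  have := le_trans (fV ax xy yb) V0.
  rewrite lee_fin le_eqVlt ltNge mdist_ge0 orbF => /eqP/mdist_positivity ->.
  case: asboolP => // _; apply: chain_sup_ge0 => //; exact: ltW.
have -> : 0%E = chain_sup (fun _ _ => 0%E) x y :> \bar R.
  by rewrite chain_sup0// ltW.
rewrite hvarE; apply: chain_sup_le_of_pairs => // u v xu uv vy.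
rewrite (Fconst u)// ?(Fconst v)//; last 2 first.
- exact: ltW (le_lt_trans xu uv).
- exact: le_trans (ltW uv) vy.
by rewrite hausdorff_distxx chain_sup0// ltW.
Qed.

End variation_bounds.

Theorem theorem6p3 (R : realType) (a b : R) (hab : a <= b)
    (X : metricType R) (F : R -> compacts X)
    (hF : (hvar F a b < +oo)%E) :
  (forall f : R -> X,
     selection a b F f ->
     (forall s t : R, a <= s -> s < t -> t <= b ->
        ((mdist (f s) (f t))%:E <= hvar F s t)%E) ->
     forall (p : R) (h : R -> R), 1 < p ->
       {in `[a, b] &, nondecreasing_fun h} ->
       (hriesz p h F a b < +oo)%E ->
       forall s t : R, a <= s -> s < t -> t <= b ->
         (riesz p h f s t <= hriesz p h F s t)%E)
  /\
  (forall (theta : R) (x : X), theta \in `[a, b] -> (F theta : set X) x ->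
     exists f : R -> X,
       [/\ selection a b F f,
           f theta = x,
           (forall s t : R, a <= s -> s < t -> t <= b ->
              ((mdist (f s) (f t))%:E <= hvar F s t)%E),
           (forall s t : R, a <= s -> s < t -> t <= b ->
              (var f s t <= hvar F s t)%E)
         & (forall (p : R) (h : R -> R), 1 < p ->
              {in `[a, b] &, nondecreasing_fun h} ->
              (hriesz p h F a b < +oo)%E ->
              forall s t : R, a <= s -> s < t -> t <= b ->
                (riesz p h f s t <= hriesz p h F s t)%E)]).
Proof.
split=> [f _ fV p h p1 hh Rfin s t sa st tb|theta x _ Fx].
  exact: (riesz_le_hriesz fV p1 hh Rfin sa tb).
(* The selection is fixed before [p] and [h] are introduced, so the same [f] serves all of them. *)
have [f [Ff fx fV]] := selection_ex Fx.
exists f; split => // [s t _ st _|s t sa _ tb|p h p1 hh Rfin s t sa _ tb].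
- exact: fV.
- by apply: (@var_le_hvar _ _ F f a b) => // *; exact: fV.
- by apply: (@riesz_le_hriesz _ _ F f a b) => // *; exact: fV.
Qed.
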